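(* Let $T=(\Omega,(\Pi_i,t_i)_{i\in N})$ be an information structure. The following three statements are equivalent: (1) there is no universal common prior for $T$; (2) there exists a weakly agreeable trade over $T$; (3) every maximal probability distribution $p\in\Delta(\Omega)$ is a universal multiplayer money pump.
   Context: $\Omega$ is a finite nonempty set of states, $N=\{1,\dots,n\}$ is a finite nonempty set of players, and $\Delta(\Omega)$ is the set of probability measures on $\Omega$ (all subsets measurable). An information structure is a tuple $T=(\Omega,(\Pi_i,t_i)_{i\in N})$ where, for each $i$, $\Pi_i$ is a partition of $\Omega$ and $t_i\colon\Omega\to\Delta(\Omega)$ satisfies $t_i(\omega)(\pi_i(\omega))=1$ for every $\omega$, where $\pi_i(\omega)$ is the element of $\Pi_i$ containing $\omega$, and $t_i$ is constant on each element of $\Pi_i$. A prior of player $i$ is a $p\in\Delta(\Omega)$ such that $p(E\cap\pi)=t_i(\omega)(E)\,p(\pi)$ for all $E\subseteq\Omega$, $\pi\in\Pi_i$, $\omega\in\pi$; a common prior is a $p\in\Delta(\Omega)$ that is a prior of every player. A nonempty set $S\subseteq\Omega$ is a common certainty component if for every $\omega\in S$ and $i\in N$ there is $E\subseteq S$ with $t_i(\omega)(E)=1$. A distribution $p\in\Delta(\Omega)$ is maximal if $p(S)>0$ for every common certainty component $S$; a universal common prior is a common prior $p$ with $p(S)>0$ for every common certainty component $S$. An event $E\subseteq\Omega$ is commonly certain at $\omega$ if there is a common certainty component $S$ with $\omega\in S\subseteq E$. A trade is a family $f=(f_i)_{i\in N}$ of functions $f_i\colon\Omega\to\mathbb{R}$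 with $\sum_{i\in N}f_i(\omega)\le 0$ for all $\omega\in\Omega$; it is weakly agreeable if there exists a state $\omega\in\Omega$ at which the event $\{\omega'\in\Omega:\int f_i\,\mathrm{d}t_i(\omega')>0 \text{ for all } i\in N\}$ is commonly certain. A semi-trade is a family $(f_i)_{i\in N}$ of functions $f_i\colon\Omega\to\mathbb{R}$ such that at every state $\omega\in\Omega$ the event $\{\omega'\in\Omega:\int f_i\,\mathrm{d}t_i(\omega')\ge 0\text{ for all }i\in N\}$ is commonly certain. A distribution $p$ is a multiplayer money pump if there exists a semi-trade $(f_i)_{i\in N}$ with $\int\sum_{i\in N}f_i\,\mathrm{d}p<0$. A universal multiplayer money pump is a maximal distribution that is a multiplayer money pump. *)

(* Defs.v *)
From HB Require Import structures.
From mathcomp Require Import all_boot all_order all_algebra.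
From mathcomp Require Import all_classical all_reals all_analysis.

Set Implicit Arguments.
Unset Strict Implicit.
Unset Printing Implicit Defensive.

Import Order.TTheory GRing.Theory Num.Theory.
Local Open Scope classical_set_scope.
Local Open Scope ring_scope.

(* The state space is a [measurableType] (hence nonempty, since the structure
   is pointed). That it is finite with all subsets measurable is a hypothesis
   of the theorem; under it, [probability Omega R] is the set of all probability
   distributions on the states and every real-valued function is integrable, so
   that [Rintegral] never takes its default value. *)

(* [partition P id setT] says that the family P of sets is a partition of the
   whole space, and [pblock P id w] is its block containing w. *)
Record info_structure (R : realType) (d : measure_display)
    (Omega : measurableType d) (n : nat) := InfoStructure {
  info_part : 'I_n -> set (set Omega) ;
  info_type : 'I_n -> Omega -> probability Omega R ;
  info_partP : forall i, partition (info_part i) id [set: Omega] ;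
  info_type_block : forall i w, info_type i w (pblock (info_part i) id w) = 1%E ;
  info_type_const : forall i B w w', info_part i B -> B w -> B w' ->
    info_type i w = info_type i w' :> (set Omega -> \bar R)
}.

Section Information.
Context (R : realType) (d : measure_display) (Omega : measurableType d) (n : nat).
Variable T : info_structure R Omega n.
Implicit Types (p : probability Omega R) (f : 'I_n -> Omega -> R).

Definition prior (i : 'I_n) p : Prop :=
  forall (E B : set Omega) (w : Omega), info_part T i B -> B w ->
    p (E `&` B) = (info_type T i w E * p B)%E.

Definition common_prior p : Prop := forall i, prior i p.

Definition certainty_component (S : set Omega) : Prop :=
  S !=set0 /\
  forall w, S w -> forall i, exists2 E, E `<=` S & info_type T i w E = 1%E.

Definition maximal p : Prop :=
  forall S, certainty_component S -> (0 < p S)%E.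

Definition universal_common_prior p : Prop :=
  common_prior p /\ forall S, certainty_component S -> (0 < p S)%E.

Definition commonly_certain (E : set Omega) (w : Omega) : Prop :=
  exists S, [/\ certainty_component S, S w & S `<=` E].

Definition trade f : Prop := forall w, \sum_(i < n) f i w <= 0.

Definition weakly_agreeable f : Prop :=
  exists w, commonly_certain
    [set w' | forall i, 0 < \int[info_type T i w']_x f i x] w.

Definition semi_trade f : Prop :=
  forall w, commonly_certain
    [set w' | forall i, 0 <= \int[info_type T i w']_x f i x] w.

Definition money_pump p : Prop :=
  exists2 f, semi_trade f & \int[p]_x (\sum_(i < n) f i x) < 0.

Definition universal_money_pump p : Prop := maximal p /\ money_pump p.

End Information.

(* Main.v *)
(* Given a common certainty component S, Gordan's alternative applied to the
   functionals f |-> E_i[f_i | w], w in S, on the families f with zero sum yields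
   either a weakly agreeable trade or nonnegative weights under which the mixture
   of the types t_i(w), w in S, is the same for all i: a common prior carried
   by S. If the second case holds for every S, averaging the common priors gives
   a universal one. An agreeable trade f on S becomes a money pump for every
   maximal distribution by replacing f_i with 1_S (f_i - E_i[f_i | .]), all of
   whose conditional expectations vanish while its sum is negative on S.
   Finally, a common prior gives every semi-trade a nonnegative expectation. *)

Require Import Defs.
From HB Require Import structures.
From mathcomp Require Import all_boot all_order all_algebra.
From mathcomp Require Import all_classical all_reals all_analysis.
From mathcomp Require Import ring lra.

Set Implicit Arguments.
Unset Strict Implicit.
Unset Printing Implicit Defensive.

Import Order.TTheory GRing.Theory Num.Theory.
Local Open Scope classical_set_scope.
Local Open Scope ring_scope.

(** * Theorems of the alternative for finitely many linear functionals *)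

Section Alternatives.
Context (R : realFieldType) (I : eqType).

Lemma scalarB (V : lmodType R) (g h : V -> R) (k : R) :
  scalar g -> scalar h -> scalar (fun x => g x - k * h x).
Proof. by move=> gl hl b x y; rewrite gl hl; ring. Qed.

Lemma scalarZ (V : lmodType R) (g : V -> R) : scalar g ->
  forall k x, g (k *: x) = k * g x.
Proof.
move=> gl k x; have g0 : g 0 = 0.
  by have := gl 1 0 0; rewrite scaler0 addr0 mul1r; lra.
by rewrite -[k *: x]addr0 gl g0 addr0.
Qed.

(* Bartl's induction: the functional [a j] is eliminated by projecting along a
   vector [x] that solves the smaller system but violates [a j x <= 0]. *)
Lemma farkas (V : lmodType R) (l : seq I) (a : I -> V -> R) (c : V -> R) :
  uniq l -> (forall i, scalar (a i)) -> scalar c ->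
  (exists2 x, (forall i, i \in l -> a i x <= 0) & 0 < c x) \/
  (exists2 lam : I -> R, (forall i, 0 <= lam i) &
     forall x, c x = \sum_(i <- l) lam i * a i x).
Proof.
elim: l a c => [|j l IH] a c /=.
  move=> _ al cl; have [[x cx]|nex] := EM (exists x, c x != 0).
    left; case: (ltrgt0P (c x)) cx => // [cx|cx] _; first by exists x.
    by exists (-1 *: x) => //; rewrite scalarZ//; lra.
  right; exists (fun=> 0) => // x; rewrite big_nil.
  by apply/eqP; apply: contrapT => /negP cx; apply: nex; exists x.
move=> /andP[jl ul] al cl.
pose extend (lam : I -> R) b i := if i == j then b else lam i.
have sum_extend lam b x : \sum_(i <- j :: l) extend lam b i * a i x =
    b * a j x + \sum_(i <- l) lam i * a i x.
  rewrite big_cons /extend eqxx; congr (_ + _); apply: eq_big_seq => i il.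
  by case: eqVneq il jl => // -> ->.
case: (IH a c ul al cl) => [[x ax cx]|[lam lam0 lamE]]; last first.
  right; exists (extend lam 0) => [i|x]; first by rewrite /extend; case: ifP.
  by rewrite sum_extend mul0r add0r lamE.
have [ajx|ajx] := leP (a j x) 0.
  by left; exists x => // i; rewrite inE => /predU1P[->|/ax].
(* [q g] is the coefficient for which [g - q g * a j] vanishes at [x]. *)
pose q g := g x / a j x : R.
have [||[y ay cy]|[lam lam0 lamE]] := IH (fun i y => a i y - q (a i) * a j y)
    (fun y => c y - q c * a j y) ul.
- by move=> i; apply: scalarB.
- exact: scalarB.
(* The projection of [y] along [x] onto the kernel of [a j]; there each functional [g] takes the
   value [g y - q g * a j y]. *)
- left; exists (- (a j y / a j x) *: x + y).
    move=> i; rewrite inE al => /predU1P[->|/ay].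
      by rewrite mulNr divfK ?gt_eqF// addNr.
    by rewrite /q => h; apply: le_trans h; rewrite le_eqVlt; apply/orP; left;
      apply/eqP; field; rewrite gt_eqF.
  rewrite cl; apply: lt_le_trans cy _; rewrite /q le_eqVlt; apply/orP; left.
  by apply/eqP; field; rewrite gt_eqF.
(* The weight of [a j] collects the subtracted multiples of [a j]. It is nonnegative because [c x]
   and [a j x] are positive while [a i x <= 0] on [l]. *)
- right; exists (extend lam (q c - \sum_(i <- l) lam i * q (a i))) => [i|y].
    rewrite /extend; case: ifP => // _; rewrite subr_ge0.
    apply: (@le_trans _ _ 0); last by rewrite /q divr_ge0 ?ltW.
    rewrite big_seq; apply: sumr_le0 => k kl; apply: mulr_ge0_le0 => //.
    by rewrite /q pmulr_lle0 ?invr_gt0// ax.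
  rewrite sum_extend.
  have -> : c y = c y - q c * a j y + q c * a j y by ring.
  rewrite lamE mulrBl mulr_suml.
  under eq_bigr do rewrite mulrBr mulrA.
  by rewrite sumrB; ring.
Qed.

(** Farkas on [V * R] with a slack variable [s]: the constraints [s <= a i x] and the objective [s].
    A solution with [s > 0] is strict for every [i]; otherwise evaluating the multiplier identity at
    [(0, 1)] and at [(x, 0)] gives the two equations. *)
Lemma gordan (V : lmodType R) (l : seq I) (a : I -> V -> R) :
  uniq l -> (forall i, scalar (a i)) ->
  (exists x, forall i, i \in l -> 0 < a i x) \/
  (exists2 lam : I -> R, (forall i, 0 <= lam i) & \sum_(i <- l) lam i = 1 /\
     forall x, \sum_(i <- l) lam i * a i x = 0).
Proof.
move=> ul al.
have [||[[x s] /= ax s0]|[lam lam0 lamE]] :=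
  @farkas (V * R^o)%type l (fun i z => z.2 - a i z.1) snd ul.
- by move=> i b [x1 x2] [y1 y2]; rewrite /= al /GRing.scale/=; ring.
- by move=> b [x1 x2] [y1 y2].
- left; exists x => i il; have := ax i il; lra.
- right; exists lam => //; have lam1 : \sum_(i <- l) lam i = 1.
    have := lamE (0, 1) => /= ->; apply: eq_bigr => i _.
    by rewrite -[X in a i X](scale0r (0 : V)) scalarZ// mul0r subr0 mulr1.
  split=> // x; have := lamE (x, 0) => /= /eqP.
  under eq_bigr do rewrite sub0r mulrN.
  by rewrite sumrN eq_sym oppr_eq0 => /eqP.
Qed.

End Alternatives.

(** * Finite mixtures of probability measures *)

Section Mixture.
Context (R : realType) (d : measure_display) (T : measurableType d).

Lemma fineK_prob (p : probability T R) E : measurable E -> (fine (p E))%:E = p E.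
Proof. by move=> mE; rewrite fineK// fin_num_measure. Qed.

Lemma exists_mixture (I : Type) (r : seq I) (lam : I -> R)
    (P : I -> probability T R) :
  (forall i, 0 <= lam i) -> \sum_(i <- r) lam i = 1 ->
  exists p : probability T R, forall E, measurable E ->
    fine (p E) = \sum_(i <- r) lam i * fine (P i E).
Proof.
move=> lam0 lam1.
have [mu muE] : exists mu : {measure set T -> \bar R}, forall E, measurable E ->
    mu E = (\sum_(i <- r) lam i * fine (P i E))%:E.
  elim: {lam1} r => [|i r [mu muE]].
    by exists mzero => E _; rewrite big_nil.
  exists (measure_add (mscale (NngNum (lam0 i)) (P i)) mu) => E mE.
  rewrite [LHS]measure_addE /mscale/= .
  by rewrite muE// big_cons EFinD EFinM fineK_prob.
have muT : mu setT = 1%E.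
  rewrite muE//; under eq_bigr do rewrite probability_setT mulr1.
  by rewrite lam1.
(* Normalizing turns [mu] into a probability without changing it, its mass being 1; the Dirac
   measure is only the default for mass zero or infinity. *)
exists (mnormalize mu (dirac point)) => E mE.
rewrite [X in fine X]/(mnormalize _ _ _) /mnormalize /= muT.
by rewrite onee_eq0/= muE//= invr1 mulr1.
Qed.

End Mixture.

(** * Integrals and probabilities as sums over the states *)

Section FiniteProbability.
Context (R : realType) (d : measure_display) (T : measurableType d).
Context (discrete : forall E : set T, measurable E).
Context (s : seq T) (s_uniq : uniq s) (s_full : forall x, x \in s).
Implicit Types (p : probability T R).

Lemma Rintegral_finite p (f : T -> R) :
  \int[p]_x f x = \sum_(x <- s) f x * fine (p [set x]).
Proof.
have UT : \big[setU/set0]_(x <- s) [set x] = [set: T].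
  rewrite -bigcup_seq; apply/seteqP; split => // x _.
  by exists x => //=; exact: s_full.
rewrite /Rintegral -[in LHS]UT integral_bigsetU_EFin//.
- rewrite (eq_bigr (fun x => (f x * fine (p [set x]))%:E)) ?sumEFin// => x _.
  rewrite (eq_integral (cst (f x)%:E)) => [|y]; last by rewrite inE => ->.
  by rewrite integral_cst// -[X in (_ * X)%E]fineK_prob// -EFinM.
- by move=> x y _ _ [z [/= -> ->]].
Qed.

Lemma fine_prob_sum p E : fine (p E) = \sum_(x <- s | x \in E) fine (p [set x]).
Proof.
have := Rintegral_finite p \1_E.
rewrite /Rintegral integral_indic// setIT => ->.
rewrite [RHS]big_mkcond/=; apply: eq_bigr => x _.
by rewrite indicE; case: (x \in E); rewrite ?mul1r ?mul0r.
Qed.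

Lemma Rintegral_cst1 p (c : R) : \int[p]_x c = c.
Proof.
rewrite Rintegral_cst// -[RHS]mulr1; congr (_ * _).
exact: (congr1 fine (probability_setT p)).
Qed.

Lemma prob_gt0_point p E : (0 < p E)%E -> exists2 x, E x & (0 < p [set x])%E.
Proof.
move=> pE; apply: contrapT => nex; move: pE.
rewrite -fineK_prob// fine_prob_sum big1 ?ltxx// => x /set_mem Ex.
suff -> : p [set x] = 0%E by [].
by apply/eqP; rewrite -measure_le0 leNgt; apply/negP => px; apply: nex; exists x.
Qed.

Lemma prob_disjoint1 p E F : p F = 1%E -> E `<=` ~` F -> p E = 0%E.
Proof.
move=> pF EF; apply/eqP; rewrite -measure_le0.
apply: le_trans (_ : p (~` F) <= 0)%E; first by rewrite le_measure ?inE.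
by rewrite probability_setC// pF subee.
Qed.

Lemma scalar_Rintegral p (V : lmodType R) (h : V -> T -> R) :
  (forall x, scalar (h ^~ x)) -> scalar (fun v => \int[p]_x h v x).
Proof.
move=> hl k u v; rewrite !Rintegral_finite mulr_sumr -big_split/=.
by apply: eq_bigr => x _; rewrite hl; ring.
Qed.

End FiniteProbability.

(** * Priors, trades and money pumps *)

Section Information.
Context (R : realType) (d : measure_display) (Omega : measurableType d).
Context (discrete : forall E : set Omega, measurable E).
Context (s : seq Omega) (s_uniq : uniq s) (s_full : forall x, x \in s).
Context (n : nat) (T : info_structure R Omega n).
Implicit Types (p : probability Omega R) (i : 'I_n).

Lemma exists_block i w : exists2 B, info_part T i B & B w.
Proof.
have [c _ _] := info_partP T i.
by have : [set: Omega] w by []; rewrite -c => -[B DB Bw]; exists B.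
Qed.

Lemma info_part_eq i B B' w :
  info_part T i B -> info_part T i B' -> B w -> B' w -> B = B'.
Proof.
have [_ t _] := info_partP T i.
by move=> DB DB' Bw B'w; apply: (t B B') => //; exists w.
Qed.

Lemma info_type_in i B w : info_part T i B -> B w -> info_type T i w B = 1%E.
Proof.
move=> DB Bw; rewrite -[RHS](info_type_block T i w); congr (info_type T i w _).
rewrite /pblock /pblock_index; case: xgetP => [B' _ [DB' B'w]|/(_ B)].
  exact: info_part_eq DB DB' Bw B'w.
by case.
Qed.

Lemma info_type_disjoint i B w w' E : info_part T i B -> B w -> ~ B w' ->
  info_type T i w' (E `&` B) = 0%E.
Proof.
move=> DB Bw nBw'; have [B' DB' B'w'] := exists_block i w'.
apply: prob_disjoint1 (info_type_in DB' B'w') _ => //.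
by move=> x [_ Bx] B'x; apply: nBw'; rewrite (info_part_eq DB DB' Bx B'x).
Qed.

Lemma certainty_componentE S w i : certainty_component T S -> S w ->
  info_type T i w S = 1%E.
Proof.
move=> [_ /[apply] /(_ i) [E ES tE]]; apply/eqP; rewrite eq_le.
by rewrite probability_le1//= -tE le_measure// inE.
Qed.

Lemma certainty_component_setT : certainty_component T setT.
Proof. by split=> [|w _ i]; [exists point|exists setT => //; exact: probability_setT]. Qed.

Lemma prob1I p E F : p F = 1%E -> p (E `&` F) = p E.
Proof.
move=> pF; have -> : p E = (p (E `\` F) + p (E `&` F))%E by exact: measureDI.
by rewrite [p (E `\` F)](prob_disjoint1 discrete pF) ?add0e// => x [].
Qed.

(** On the block of [w] the type is constant and has full mass; on any other block both sides
    vanish. Hence mixtures of the types of [i] are priors of [i]. *)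
Lemma prior_info_type i w : prior T i (info_type T i w).
Proof.
move=> E B w' DB Bw'; have [Bw|nBw] := EM (B w).
  rewrite (info_type_const DB Bw' Bw) (info_type_in DB Bw) mule1.
  by rewrite prob1I// (info_type_in DB).
by rewrite (info_type_disjoint _ DB Bw' nBw) -[B]setTI
  (info_type_disjoint _ DB Bw' nBw) mule0.
Qed.

Lemma priorP i p : prior T i p <-> forall E B w, info_part T i B -> B w ->
  fine (p (E `&` B)) = fine (info_type T i w E) * fine (p B).
Proof.
split=> pp E B w DB Bw; first by rewrite (pp _ _ w)// fineM// fin_num_measure.
by rewrite -fineK_prob// (pp _ _ w)// EFinM !fineK_prob.
Qed.

(** The equation defining a prior is linear in the measure. *)
Lemma prior_mixture i p (J : eqType) (r : seq J) (lam : J -> R)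
    (P : J -> probability Omega R) :
  (forall j, j \in r -> prior T i (P j)) ->
  (forall E, fine (p E) = \sum_(j <- r) lam j * fine (P j E)) ->
  prior T i p.
Proof.
move=> Pp pE; apply/priorP => E B w DB Bw; rewrite !pE mulr_sumr.
apply: eq_big_seq => j jr.
by have /priorP /(_ E B w DB Bw) -> := Pp j jr; ring.
Qed.

(** The law of iterated expectations. After exchanging the sums, only the states [w] in the block
    [B] of [x] give mass to [x], all of them the same mass, so the coefficient of [f x] is the type
    of [x] at [[set x]] times [p B]. *)
Lemma prior_integral i p f : prior T i p ->
  \int[p]_x f x =
  \sum_(w <- s) fine (p [set w]) * \int[info_type T i w]_x f x.
Proof.
move=> pp; rewrite (Rintegral_finite discrete s_uniq s_full).
under [RHS]eq_bigr do rewrite (Rintegral_finite discrete s_uniq s_full) mulr_sumr.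
rewrite exchange_big/=; apply: eq_bigr => x _.
under eq_bigr do rewrite mulrCA; rewrite -mulr_sumr; congr (_ * _).
have [B DB Bx] := exists_block i x.
have -> : [set x] = [set x] `&` B by apply/seteqP; split=> [y ->//|y []].
move/priorP: (pp) => /(_ [set x] B x DB Bx) ->.
rewrite (fine_prob_sum discrete s_uniq s_full p B) mulr_sumr big_mkcond/=.
apply: eq_bigr => w _; case: ifPn.
  rewrite inE => Bw; rewrite mulrC (info_type_const DB Bx Bw).
  by rewrite prob1I ?(info_type_in DB).
rewrite notin_setE => nBw.
by rewrite (info_type_disjoint _ DB Bx nBw) mulr0.
Qed.

(* Projection onto the families of functions with zero sum. *)
Definition balanced (f : 'I_n -> Omega -> R) : 'I_n -> Omega -> R :=
  fun i x => f i x - n%:R^-1 * \sum_(k < n) f k x.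

Lemma sum_balanced f x : (0 < n)%N -> \sum_(i < n) balanced f i x = 0.
Proof.
move=> n0; rewrite sumrB sumr_const card_ord -[X in _ - X]mulr_natl mulrA mulfV ?mul1r ?subrr//.
by rewrite pnatr_eq0 -lt0n.
Qed.

Lemma scalar_balanced i x :
  scalar (fun f : 'I_n -> Omega -> R => balanced f i x).
Proof.
move=> k f g; have E j : (k *: f + g) j x = k * f j x + g j x by [].
by rewrite /balanced E (eq_bigr _ (fun j _ => E j)) big_split/= -mulr_sumr; ring.
Qed.

Lemma trade_or_prior S : (0 < n)%N -> certainty_component T S ->
  (exists2 f, trade f & weakly_agreeable T f) \/
  (exists2 p, common_prior T p & (0 < p S)%E).
Proof.
move=> n0 CS.
pose l := [seq j <- [seq (i, w) | i <- enum 'I_n, w <- s] | j.2 \in S].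
have ul : uniq l.
  by rewrite filter_uniq// allpairs_uniq ?enum_uniq// => -[? ?] [? ?].
have lE i w : S w -> (i, w) \in l.
  by move=> Sw; rewrite mem_filter mem_set//= allpairs_f// mem_enum.
have lS j : j \in l -> S j.2 by rewrite mem_filter => /andP[/set_mem].
(* Composing with [balanced] encodes the zero-sum constraint, so that Gordan applies on the whole
   space of families. *)
pose a (j : 'I_n * Omega) (f : 'I_n -> Omega -> R) :=
  \int[info_type T j.1 j.2]_x balanced f j.1 x.
have al j : scalar (a j).
  by apply: (scalar_Rintegral discrete s_uniq s_full) => x; exact: scalar_balanced.
have [[f af]|[lam lam0 [lam1 lamE]]] := gordan ul al; [left|right].
  exists (balanced f) => [w|]; first by rewrite sum_balanced.
  have [[w Sw] _] := CS; exists w, S; split => // w' Sw' i.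
  exact: (af (i, w') (lE _ _ Sw')).
have [p pE] := exists_mixture (fun j => info_type T j.1 j.2) lam0 lam1.
(* The weights of the pairs of player [k] turn out to sum to [1 / n], so [p] should be the mixture
   of the types of [k] with weights [n * lam]. *)
exists p.
  move=> k; apply: (@prior_mixture k p _ [seq j <- l | j.1 == k]
    (fun j => n%:R * lam j) (fun j => info_type T j.1 j.2)).
    by move=> j; rewrite mem_filter => /andP[/eqP <- _]; exact: prior_info_type.
  move=> E; rewrite pE// [RHS]big_filter.
  (* Test family paying the indicator of [E] to [k] alone. Balancing subtracts [\1_E / n] from every
     player, so [lamE f] says that the share of [k] in [p E] is [1 / n]. *)
  pose f i x := (i == k)%:R * \1_E x : R.
  have sum_f x : \sum_(i < n) f i x = \1_E x.
    by rewrite (bigD1 k)//= big1 /f => [|i /negPf ->]; rewrite ?eqxx ?mul0r ?mul1r ?addr0.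
  have af j : a j f = ((j.1 == k)%:R - n%:R^-1) * fine (info_type T j.1 j.2 E).
    rewrite /a (Rintegral_finite discrete s_uniq s_full).
    rewrite (fine_prob_sum discrete s_uniq s_full _ E) mulr_sumr [RHS]big_mkcond/=.
    apply: eq_bigr => x _; rewrite /balanced sum_f /f indicE.
    by case: (x \in E); rewrite ?mulr1// !mulr0 subr0 mul0r.
  pose G j := (j.1 == k)%:R * fine (info_type T j.1 j.2 E).
  have lamk : \sum_(j <- l) lam j * G j =
      n%:R^-1 * \sum_(j <- l) lam j * fine (info_type T j.1 j.2 E).
    apply/eqP; rewrite -subr_eq0 mulr_sumr -sumrB -[eqbRHS](lamE f); apply/eqP.
    by apply: eq_bigr => j _; rewrite af /G; ring.
  transitivity (n%:R * \sum_(j <- l) lam j * G j).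
    have n1 : n%:R != 0 :> R by rewrite pnatr_eq0 -lt0n.
    by rewrite lamk mulrA mulfV// mul1r.
  rewrite mulr_sumr [RHS]big_mkcond/=; apply: eq_bigr => j _.
  by rewrite /G; case: (j.1 == k); rewrite /=; ring.
rewrite -fineK_prob// lte_fin pE// (eq_big_seq lam) ?lam1// => j jl.
by rewrite (certainty_componentE _ CS (lS j jl)) mulr1.
Qed.

Lemma exists_universal_common_prior :
  (forall S, certainty_component T S ->
     exists2 p, common_prior T p & (0 < p S)%E) ->
  exists p, universal_common_prior T p.
Proof.
move=> Cp; have [p0 p0c _] := Cp _ certainty_component_setT.
(* For each state, [P] picks a common prior charging it if there is one, and [p0] otherwise. The
   uniform average of the [P x] then charges every state that some common prior charges. *)
have /choice[P PP] x : exists p, common_prior T p /\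
    forall q, common_prior T q -> (0 < q [set x])%E -> (0 < p [set x])%E.
  have [[q [qc qx]]|nex] := EM (exists q, common_prior T q /\ (0 < q [set x])%E).
    by exists q.
  by exists p0; split => // q qc qx; exfalso; apply: nex; exists q.
have s0 : (0 < size s)%N by case: (s) (s_full point).
have [||p pE] := @exists_mixture _ _ _ _ s (fun=> (size s)%:R^-1) P.
- by move=> _; rewrite invr_ge0.
- rewrite big_const_seq count_predT iter_addr_0 -[LHS]mulr_natl mulfV//.
  by rewrite pnatr_eq0 -lt0n.
exists p; split.
  move=> i; apply: (prior_mixture (r := s) (lam := fun=> (size s)%:R^-1)
    (P := P)) => [x _|E]; first by have [+ _] := PP x; apply.
  by rewrite pE.
move=> S CS; have [q qc qS] := Cp S CS.
have [x Sx qx] := prob_gt0_point discrete s_uniq s_full qS.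
have [_ /(_ q qc qx)] := PP x; rewrite -(fineK_prob (P x))// lte_fin => Px.
rewrite -fineK_prob// lte_fin pE//.
apply: lt_le_trans (_ : (size s)%:R^-1 * fine (P x S) <= _).
  rewrite mulr_gt0 ?invr_gt0 ?ltr0n//; apply: lt_le_trans Px _.
  by rewrite fine_le ?fin_num_measure// le_measure ?inE// => y ->.
rewrite (big_rem x)//= lerDl sumr_ge0// => y _.
by rewrite mulr_ge0 ?invr_ge0// fine_ge0.
Qed.

Lemma agreeable_money_pump f p : (0 < n)%N ->
  trade f -> weakly_agreeable T f -> maximal T p -> money_pump T p.
Proof.
move=> n0 tf [w [S [CS Sw Sf]]] mp.
pose c i x := \int[info_type T i x]_y f i y.
pose g i x := if x \in S then f i x - c i x else 0.
have supp i x y : S x -> ~ S y -> info_type T i x [set y] = 0%E.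
  move=> Sx nSy; apply: (prob_disjoint1 discrete (certainty_componentE i CS Sx)).
  by move=> z ->.
exists g.
  (* The conditional expectations of [g] vanish at every state, so the whole space serves as the
     component. *)
  move=> w'; exists setT; split => //; first exact: certainty_component_setT.
  move=> x _ i /=; have [B DB Bx] := exists_block i x.
  rewrite (Rintegral_finite discrete s_uniq s_full).
  (* If the block misses [S], then [g i] is zero on it. Otherwise the type on [B] equals that of
     some [z] in [S], hence is carried by [B] and [S], where [g i] is [f i] minus the constant
     [c i z]. *)
  have [[z [Bz Sz]]|BS] := EM (B `&` S !=set0); last first.
    rewrite big1// => y _; rewrite /g; case: ifPn; rewrite ?mul0r// inE => Sy.
    rewrite (prob_disjoint1 discrete (info_type_in DB Bx)) ?mulr0// => _ -> By.
    by apply: BS; exists y.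
  rewrite (info_type_const DB Bx Bz).
  rewrite (eq_bigr (fun y => (f i y - c i z) * fine (info_type T i z [set y]))).
    under eq_bigr do rewrite mulrBl.
    rewrite sumrB -(Rintegral_finite discrete s_uniq s_full _ (f i)).
    rewrite -(Rintegral_finite discrete s_uniq s_full _ (fun=> c i z)).
    by rewrite Rintegral_cst1// subrr.
  move=> y _.
  have [By|nBy] := EM (B y); last first.
    rewrite (prob_disjoint1 discrete (info_type_in DB Bz)) ?mulr0// => _ ->//.
  rewrite /g; case: ifPn => [_|].
    by rewrite /c !(Rintegral_finite discrete s_uniq s_full) (info_type_const DB By Bz).
  by rewrite notin_setE => /(supp i z y Sz) ->; rewrite !mulr0.
rewrite (Rintegral_finite discrete s_uniq s_full).
have gS x : S x -> \sum_(i < n) g i x < 0.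
  move=> Sx; rewrite /g mem_set// sumrB.
  apply: le_lt_trans (_ : _ <= 0 - \sum_(i < n) c i x) _.
    by rewrite lerD2r tf.
  (* Strictness comes from one player, whose conditional expectation is positive on [S]. *)
  rewrite sub0r oppr_lt0 (bigD1 (Ordinal n0))//=.
  by rewrite ltr_wpDr ?sumr_ge0 ?Sf// => i _; rewrite ltW// Sf.
have gle x : \sum_(i < n) g i x <= 0.
  have [/gS/ltW//|nSx] := EM (S x).
  by rewrite big1// => i _; rewrite /g memNset.
have [x Sx px] := prob_gt0_point discrete s_uniq s_full (mp _ CS).
rewrite (big_rem x)//=; apply: ltr_wnDr.
  by apply: sumr_le0 => y _; rewrite mulr_le0_ge0 ?fine_ge0.
by rewrite nmulr_rlt0 ?gS// -lte_fin fineK_prob.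
Qed.

(** Each player's integral is a [p]-average of conditional expectations. These are nonnegative
    everywhere, since what is commonly certain at a state holds at that state. *)
Lemma universal_prior_not_pump p : common_prior T p -> ~ money_pump T p.
Proof.
move=> pc [f sf]; apply/negP; rewrite -leNgt.
rewrite (Rintegral_finite discrete s_uniq s_full).
under eq_bigr do rewrite mulr_suml; rewrite exchange_big/=.
apply: sumr_ge0 => i _; rewrite -(Rintegral_finite discrete s_uniq s_full).
rewrite (prior_integral _ (pc i)); apply: sumr_ge0 => w _.
apply: mulr_ge0; first by rewrite fine_ge0.
by have [S [_ Sw Sf]] := sf w; exact: (Sf _ Sw i).
Qed.

End Information.

Theorem theorem60 (R : realType) (d : measure_display)
    (Omega : measurableType d)
    (Omega_finite : finite_set [set: Omega])
    (Omega_discrete : forall E : set Omega, measurable E)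
    (n : nat) (n_gt0 : (0 < n)%N) (T : info_structure R Omega n) :
  [<-> ~ (exists p : probability Omega R, universal_common_prior T p);
       exists2 f : 'I_n -> Omega -> R, trade f & weakly_agreeable T f;
       forall p : probability Omega R, maximal T p -> universal_money_pump T p].
Proof.
have [s0 s0E] := (finite_seqP _).1 Omega_finite.
have us := undup_uniq s0; have sT x : x \in undup s0.
  by rewrite mem_undup; have : [set: Omega] x by []; rewrite s0E.
tfae.
- move=> nup; apply: contrapT => ntrade; apply: nup.
  apply: (exists_universal_common_prior Omega_discrete us sT) => S CS.
  by have [|] := trade_or_prior Omega_discrete us sT n_gt0 CS.
- move=> [f tf wf] p mp; split => //.
  exact: (agreeable_money_pump Omega_discrete us sT n_gt0 tf wf mp).
- move=> pump [p [pc pmax]].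
  (* A universal common prior is itself a maximal distribution. *)
  have [_] := pump p pmax.
  exact: (universal_prior_not_pump Omega_discrete us sT pc).
Qed.
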